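(* Let $\epsilon,\delta\in(0,1]$, let $B>0$, let $k\ge 1$ be an integer, and let $m\ge 1$ be the number of numerical features of a relation $R$, every tuple of which has feature vector $(t[f_1],\dots,t[f_m])$ with $\ell_2$ norm at most $B$. The Factorized Privacy Mechanism (FPM) described below, applied to $R$ with a join key $A$ (or with $A=\text{null}$), order $k$ and budget $(\epsilon,\delta)$, is $(\epsilon,\delta)$-differentially private.
   Context: Monomials: for $i\ge 0$, an $i$-order monomial of the features $f_1,\dots,f_m$ is $f_1^{k_1}\cdots f_m^{k_m}$ with non-negative integers $k_j$ summing to $i$; distinct monomials are counted once (so e.g. $f_1f_2$ and $f_2f_1$ are the same monomial). The $0$-order monomial is the constant $1$, whose sum over a relation is the count. For a relation $S$ and a monomial $p$, the aggregated monomial is $\sum_{t\in S}p(t)$. The mechanism FPM takes a relation $R$ with numerical features $f_1,\dots,f_m$, possibly a categorical join key $A$ whose domain $\mathrm{dom}(A)$ is public, an order $k$, and $(\epsilon,\delta)$. Let $c_i=4$ if $i$ is odd, $c_i=1$ if $i$ is even and $m=1$, and $c_i=2$ if $i$ is even and $m\ge 2$. Let $\Delta_u=\sqrt{\sum_{i=1}^k c_iB^{2i}}$. (Union case, $A=\text{null}$): set $\Delta=\Delta_u$, $\sigma=\sqrt{2\ln(1.25/\delta)}\,\Delta/\epsilon$, and output, for every monomial $p$ of order $1,\dots,k$, the value $\sum_{t\in R}p(t)+e_p$, where the $e_p$ are i.i.d. $\mathcal N(0,\sigma^2)$. (Join case, $A\neq\text{null}$): set $\Delta=\max\big(\Delta_u,\sqrt{2\sum_{i=0}^kB^{2i}}\big)$,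 $\sigma=\sqrt{2\ln(1.25/\delta)}\,\Delta/\epsilon$, and output, for every $a\in\mathrm{dom}(A)$ and every monomial $p$ of order $0,1,\dots,k$, the value $\sum_{t\in R,\,t[A]=a}p(t)+e_{a,p}$ (the sum being $0$ if no tuple has $A=a$), where all $e_{a,p}$ are i.i.d. $\mathcal N(0,\sigma^2)$. Differential privacy (bounded version): a randomized algorithm $f$ on relations is $(\epsilon,\delta)$-DP if for all relations $R_1,R_2$ with the same number of rows that differ in the values of exactly one row (including possibly its join key value), and every measurable set $S$ of outputs, $\Pr[f(R_1)\in S]\le e^{\epsilon}\Pr[f(R_2)\in S]+\delta$. Both $R_1,R_2$ range over relations satisfying the $\ell_2$-norm bound $B$. *)

(* Defs.v *)
From HB Require Import structures.
From mathcomp Require Import all_boot all_order all_algebra.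
From mathcomp Require Import all_classical all_reals all_analysis.
Set Implicit Arguments. Unset Strict Implicit. Unset Printing Implicit Defensive.
Import Order.TTheory GRing.Theory Num.Theory.
Local Open Scope classical_set_scope.
Local Open Scope ring_scope.

Section FPM.
Context {R : realType}.

(** A monomial f_1^{k_1} ... f_m^{k_m} of order <= k is represented by its
    exponent vector; distinct monomials <-> distinct exponent vectors. *)
Definition mono_order (m k : nat) (p : {ffun 'I_m -> 'I_k.+1}) : nat :=
  (\sum_(j < m) nat_of_ord (p j))%N.

Definition UMono (m k : nat) :=
  {p : {ffun 'I_m -> 'I_k.+1} | (0 < mono_order p <= k)%N}.
Definition JMono (m k : nat) :=
  {p : {ffun 'I_m -> 'I_k.+1} | (mono_order p <= k)%N}.

Definition eval_mono (m k : nat) (x : 'I_m -> R) (p : {ffun 'I_m -> 'I_k.+1}) : R :=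
  \prod_(j < m) x j ^+ p j.

Definition l2norm (m : nat) (x : 'I_m -> R) : R := Num.sqrt (\sum_(j < m) x j ^+ 2).

Definition c_coef (m i : nat) : R :=
  if odd i then 4%:R else if m == 1%N then 1 else 2%:R.

Definition Delta_u (m k : nat) (B : R) : R :=
  Num.sqrt (\sum_(1 <= i < k.+1) c_coef m i * B ^+ (2 * i)).

Definition Delta_join (m k : nat) (B : R) : R :=
  Num.max (Delta_u m k B) (Num.sqrt (2%:R * \sum_(0 <= i < k.+1) B ^+ (2 * i))).

Definition fpm_sigma (eps delta Delta : R) : R :=
  Num.sqrt (2%:R * ln ((5%:R / 4%:R) / delta)) * Delta / eps.

(** Union case (A = null): relation with n rows, row t has features r t. *)
Definition FPM_union (m k n : nat) (r : 'I_n -> ('I_m -> R))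
  (Omega : Type) (e : UMono m k -> Omega -> R) : Omega -> (UMono m k -> R) :=
  fun w p => \sum_(t < n) eval_mono (r t) (val p) + e p w.

(** Join case: row t = (features, join key in the public domain K). *)
Definition FPM_join (m k n : nat) (K : finType) (r : 'I_n -> ('I_m -> R) * K)
  (Omega : Type) (e : (K * JMono m k)%type -> Omega -> R)
  : Omega -> ((K * JMono m k)%type -> R) :=
  fun w ap => \sum_(t < n | (r t).2 == ap.1) eval_mono (r t).1 (val ap.2) + e ap w.

(** Product (= Borel) sigma-algebra on R^I, I finite: generated by the
    coordinate cylinders. *)
Definition coord_cyl (I : Type) : set (set (I -> R)) :=
  [set C | exists i B, measurable B /\ C = (fun f : I -> R => f i) @^-1` B].
Definition out_measurable (I : Type) (S : set (I -> R)) : Prop :=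
  smallest (sigma_algebra (@setT (I -> R))) (@coord_cyl I) S.

Definition iid_normal (d : measure_display) (T : measurableType d)
  (P : probability T R) (I : finType) (e : I -> {RV P >-> R}) (sigma : R) : Prop :=
  (forall i A, measurable A -> distribution P (e i) A = normal_prob 0 sigma A) /\
  (forall (J : {set I}) (B : I -> set R), (forall i, measurable (B i)) ->
     P (\bigcap_(i in [set i | i \in J]) (e i @^-1` B i))
     = (\prod_(i in J) P (e i @^-1` B i))%E).

Definition neighbours (n : nat) (Row : Type) (ok : Row -> Prop)
  (r1 r2 : 'I_n -> Row) : Prop :=
  (forall t, ok (r1 t)) /\ (forall t, ok (r2 t)) /\
  exists i, r1 i <> r2 i /\ forall j, j != i -> r1 j = r2 j.

Definition DP (d : measure_display) (Omega : measurableType d)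
  (P : probability Omega R) (X O : Type) (nb : X -> X -> Prop)
  (measO : set (set O)) (M : X -> Omega -> O) (eps delta : R) : Prop :=
  forall x1 x2, nb x1 x2 -> forall S, measO S ->
    (P (M x1 @^-1` S) <= (expR eps)%:E * P (M x2 @^-1` S) + delta%:E)%E.

End FPM.

(* Main.v *)
(** For Gaussian noise, the law of a shifted noise vector has an explicit
    exponential likelihood ratio [L_v] with respect to the unshifted one. If [a]
    and [b] are the exact answers on neighbouring relations, then for every
    [lam >= 1/2] one has pointwise
    [L_a <= e^eps L_b + (1/2) e^(-lam eps) L_a^(1 + lam) / L_b^lam], and the last
    term is a constant times [L_c] with [c = (1 + lam) a - lam b]; since [L_c] is
    a probability density, integrating bounds the failure probability by that
    constant, which is at most [delta] for a suitable [lam].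

    For the l2-sensitivity, a monomial [p] of order [i] arises from at least one
    map from positions to variables, so [sum_p p(x)^2 <= |x|^(2 i)] by expanding
    [(sum_j x_j^2)^i]. When [i] is even, [p] either is nonnegative or arises from
    at least two maps, hence [(p(x) - p(y))^2] is at most the number of its maps
    times [p(x)^2 + p(y)^2]; this gives [c_i = 2] instead of [4]. *)
Require Import Defs.
From HB Require Import structures.
From mathcomp Require Import all_boot all_order all_algebra.
From mathcomp Require Import all_classical all_reals all_analysis.
From mathcomp Require Import perm ring lra.
From mathcomp Require Import measurable_realfun.
Import Order.TTheory GRing.Theory Num.Theory.
Local Open Scope classical_set_scope.
Local Open Scope ring_scope.

Set Implicit Arguments.
Unset Strict Implicit.

(** * Shifting a Gaussian vector *)

Section integral_transfer.
Local Open Scope ereal_scope.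
Context d1 d2 (X : measurableType d1) (Y : measurableType d2) (R : realType).
Variables (mu : {measure set X -> \bar R}) (nu : {measure set Y -> \bar R}).
Variables (phi : X -> Y) (f : X -> R) (g : Y -> R).
Hypotheses (mphi : measurable_fun setT phi).
Hypotheses (mf : measurable_fun setT f) (mg : measurable_fun setT g).
Hypotheses (f0 : forall x, (0 <= f x)%R) (g0 : forall y, (0 <= g y)%R).
Hypothesis fg : forall A, measurable A ->
  \int[mu]_(x in phi @^-1` A) (f x)%:E = \int[nu]_(y in A) (g y)%:E.

Import HBNNSimple.

(** By [fg], the image under [phi] of the measure with density [f] is the measure with density [g].
    This passes from indicators to [h] through simple functions and monotone convergence. *)
Lemma ge0_integral_transfer (h : Y -> \bar R) :
  measurable_fun setT h -> (forall y, 0 <= h y) ->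
  \int[mu]_x ((f x)%:E * h (phi x)) = \int[nu]_y ((g y)%:E * h y).
Proof.
move=> mh h0.
pose s := nnsfun_approx measurableT mh.
have mphiA A : measurable A -> measurable (phi @^-1` A).
  by move=> mA; rewrite -[X in measurable X]setTI; exact: mphi.
have lim_s y : (s n y)%:E @[n --> \oo] --> h y.
  by apply: cvg_nnsfun_approx => // *; exact: h0.
have nd_s y : nondecreasing_seq (fun n => (s n y)%:E : \bar R).
  by move=> m n mn; rewrite lee_fin; exact/lefP/nd_nnsfun_approx.
(* [MC], and [S] below, allow any weight and map, so that both sides are instances: [f] with [phi],
   and [g] with the identity. *)
have MC d (Z : measurableType d) (m : {measure set Z -> \bar R}) (w : Z -> R)
    (psi : Z -> Y) : measurable_fun setT w -> (forall z, (0 <= w z)%R) ->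
    measurable_fun setT psi ->
    \int[m]_z ((w z)%:E * h (psi z)) =
    limn (fun n => \int[m]_z ((w z)%:E * (s n (psi z))%:E)).
  move=> mw w0 mpsi; rewrite -monotone_convergence//.
  - apply: eq_integral => z _; apply/esym/cvg_lim => //.
    by apply: cvgeZl => //; exact: lim_s.
  - move=> n; apply: emeasurable_funM; first exact/measurable_EFinP.
    by apply/measurable_EFinP; apply: measurableT_comp.
  - by move=> n z _; rewrite mule_ge0// lee_fin.
  - by move=> z _ a b ab; rewrite lee_wpmul2l// ?lee_fin//; exact: nd_s.
rewrite (MC _ _ _ f phi)// (MC _ _ _ g id)//; congr (limn _).
apply/funext => n.
have S d (Z : measurableType d) (m : {measure set Z -> \bar R}) (w : Z -> R)
    (psi : Z -> Y) : measurable_fun setT w -> (forall z, (0 <= w z)%R) ->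
    measurable_fun setT psi ->
    \int[m]_z ((w z)%:E * (s n (psi z))%:E) =
    \sum_(k \in range (s n)) (k%:E *
       \int[m]_(z in psi @^-1` (s n @^-1` [set k])) (w z)%:E).
  move=> mw w0 mpsi.
  have mpsiA A : measurable A -> measurable (psi @^-1` A).
    by move=> mA; rewrite -[X in measurable X]setTI; exact: mpsi.
  have mk k : measurable (psi @^-1` (s n @^-1` [set k])).
    by apply: mpsiA; rewrite -[X in measurable X]setTI; exact: measurable_funP.
  transitivity (\int[m]_z \sum_(k \in range (s n))
     ((w z)%:E * (k * \1_(s n @^-1` [set k]) (psi z))%:E)).
    apply: eq_integral => z _; rewrite fimfunE -fsumEFin// ge0_mule_fsumr//.
    by move=> k; exact: nnfun_muleindic_ge0.
  rewrite ge0_integral_fsum//; last 2 first.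
  - move=> k; apply: emeasurable_funM; first exact/measurable_EFinP.
    apply/measurable_EFinP; apply: measurable_funM => //.
    have -> : (fun z => \1_(s n @^-1` [set k]) (psi z)) =
        \1_(psi @^-1` (s n @^-1` [set k])) :> (Z -> R).
      by apply/funext => z; rewrite !indicE.
    exact: measurable_indic.
  - move=> k z _; rewrite mule_ge0// ?lee_fin//.
    by have := nnfun_muleindic_ge0 (s n) k (psi z); rewrite lee_fin.
  (* Writing [k] as a value of the approximation supplies the nonnegativity needed to move it across
     the integral. *)
  apply: eq_fsbigr => k; rewrite inE => -[y _ <-]; set r := s n y.
  rewrite [in RHS]integral_mkcond -ge0_integralZl//; last 3 first.
  - apply/(measurable_restrictT _ _).1 => //.
    by apply: measurable_funTS; exact/measurable_EFinP.
  - by move=> z _; apply: erestrict_ge0 => // t _; rewrite lee_fin.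
  - by rewrite lee_fin.
  apply: eq_integral => z _; rewrite patchE indicE -[psi z \in _]/(z \in psi @^-1` _).
  by case: ifP => _; rewrite ?mulr1 ?mulr0 ?mule0// muleC.
rewrite (S _ _ _ f phi)// (S _ _ _ g id)//.
apply: eq_fsbigr => k _; congr (_ * _); apply: fg.
by rewrite -[X in measurable X]setTI; exact: measurable_funP.
Qed.

End integral_transfer.

(** * Translation of Lebesgue measure and of the normal law *)

Section lebesgue_translation.
Context {R : realType}.
Implicit Types (v : R) (A : set R).

Let tr v : measurableTypeR R -> measurableTypeR R := shift v.

Let measurable_tr v : measurable_fun setT (tr v).
Proof. exact: measurable_funD. Qed.

HB.instance Definition _ v := isMeasurableFun.Build _ _ _ _ (tr v) (measurable_tr v).

(** Translation preserves the length of half-open intervals, and these lengths determine the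
    measure. *)
Lemma lebesgue_measure_shift v A : measurable A ->
  lebesgue_measure (shift v @^-1` A) = lebesgue_measure A.
Proof.
move=> mA; apply/esym.
apply: (@lebesgue_measure_unique R (pushforward lebesgue_measure (tr v))) =>
  //= _ [[a b]] _ <-.
rewrite /pushforward/= (_ : _ @^-1` _ = `]a - v, b - v]%classic); last first.
  by apply/seteqP; split => x /=; rewrite !in_itv/= ltrBlDr lerBrDr.
rewrite !lebesgue_measure_itv/= !lte_fin ltrD2r; case: ifP => // _.
by rewrite -!EFinB; congr EFin; ring.
Qed.

Lemma normal_prob_shift v s A : s != 0 -> measurable A ->
  normal_prob 0 s (shift v @^-1` A) = normal_prob v s A.
Proof.
move=> s0 mA; rewrite /normal_prob.
transitivity (\int[pushforward lebesgue_measure (tr v)]_(x in A)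
    (normal_pdf v s x)%:E)%E; last first.
  by apply: eq_measure_integral => //= B mB _; exact: lebesgue_measure_shift.
rewrite ge0_integral_pushforward//=.
- apply: eq_integral => x _ /=; congr EFin.
  by rewrite !normal_pdfE// /normal_fun /tr/= subr0 addrK.
- by apply/measurable_EFinP/measurable_funTS; exact: measurable_normal_pdf.
- by move=> x _; rewrite lee_fin normal_pdf_ge0.
Qed.

End lebesgue_translation.

(** The sets with measurable preimage under [X] form a sigma-algebra. *)
Lemma g_sigma_preimage_measurable d (Omega : measurableType d) (T : Type)
    (G : set (set T)) (X : Omega -> T) (S : set T) :
  (forall A, G A -> measurable (X @^-1` A)) -> <<s G >> S ->
  measurable (X @^-1` S).
Proof.
move=> mX; apply: (smallest_sub (X := [set S | measurable (X @^-1` S)])) => //.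
split=> /=.
- by rewrite preimage_set0.
- by move=> A mA; rewrite setTD preimage_setC; exact: measurableC.
- by move=> F mF; rewrite preimage_bigcup; exact: bigcupT_measurable.
Qed.

(** * Law of a shifted Gaussian vector *)

Section gaussian_shift.
Context d (Omega : measurableType d) (R : realType) (P : probability Omega R).
Variables (I : finType) (e : I -> {RV P >-> R}) (sigma : R).
Hypotheses (s0 : sigma != 0) (iid : iid_normal e sigma).

(** The density of N(v, s^2) relative to N(0, s^2). *)
Definition gauss_lr (s v x : R) := expR (v * x / s ^+ 2 - v ^+ 2 / (s ^+ 2 *+ 2)).

Lemma gauss_lr0 x : gauss_lr sigma 0 x = 1.
Proof. by rewrite /gauss_lr expr0n/= !mul0r subr0 expR0. Qed.

Lemma gauss_lr_pdf v x :
  normal_pdf 0 sigma x * gauss_lr sigma v x = normal_pdf v sigma x.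
Proof.
rewrite !normal_pdfE// -mulrA; congr (_ * _).
rewrite /normal_fun /gauss_lr -expRD; congr expR.
by field.
Qed.

Lemma measurable_gauss_lr v : measurable_fun setT (gauss_lr sigma v).
Proof.
apply: measurableT_comp => //; apply: measurable_funB => //.
by apply: measurable_funM => //; exact: measurable_funM.
Qed.

Let box (B : I -> set R) := \bigcap_i (e i @^-1` B i).

Let measurable_box B : (forall i, measurable (B i)) -> measurable (box B).
Proof.
move=> mB; apply: fin_bigcap_measurable => // i _.
by rewrite -[X in measurable X]setTI; exact: measurable_funP.
Qed.

Let boxE B a w : box B w <->
  (\bigcap_(i in [set i | i != a]) (e i @^-1` B i)) w /\ B a (e a w).
Proof.
split=> [bw|[bw Ba] i _]; last by have [->//|/bw] := eqVneq i a.
by split=> [i _|]; exact: bw.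
Qed.

Let joint_lr (u : I -> R) w := \prod_i gauss_lr sigma (u i) (e i w).

Let measurable_joint_lr u : measurable_fun setT (joint_lr u).
Proof.
apply: measurable_prod => i _.
by apply: measurableT_comp => //; exact: measurable_gauss_lr.
Qed.

Let joint_lr_ge0 u w : 0 <= joint_lr u w.
Proof. by apply: prodr_ge0 => i _; exact: expR_ge0. Qed.

Let fineN v (A : set R) : measurable A ->
  (fine (normal_prob v sigma A))%:E = normal_prob v sigma A.
Proof. by move=> mA; rewrite fineK// fin_num_measure. Qed.

(* Coordinates are shifted one at a time: with all other coordinates frozen into
   the weight [Y], the law of [e a] under [Y dP] is a multiple of N(0, sigma^2),
   and [ge0_integral_transfer] inserts the likelihood ratio of [e a]. *)
Let integral_box (s : seq I) (u : I -> R) (B : I -> set R) :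
  (forall i, i \notin s -> u i = 0) -> (forall i, measurable (B i)) ->
  (\int[P]_(w in box B) (joint_lr u w)%:E =
   (\prod_i fine (normal_prob (u i) sigma (B i)))%:E)%E.
Proof.
(* [s] lists the coordinates that may be shifted. [u] and [B] stay general: the inductive hypothesis
   is used with [u a] reset to 0 and one side of the box replaced. *)
elim: s => [|a s IH] in u B *.
  move=> u0 mB; have {}u0 i : u i = 0 by exact: u0.
  transitivity (\int[P]_(w in box B) (cst 1%E w))%E.
    apply: eq_integral => w _; rewrite /joint_lr big1// => i _.
    by rewrite u0 gauss_lr0.
  rewrite integral_cst//= ?mul1e; last exact: measurable_box.
  have /(_ [set: I]%SET B mB) := iid.2.
  rewrite (_ : \bigcap_(i in _) _ = box B); last first.
    by apply: eq_bigcapl; split=> i //= _; rewrite inE.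
  move=> ->; rewrite -prodEFin; apply: eq_big => [i|i _]; first by rewrite inE.
  by rewrite u0 fineN//; exact: (iid.1 i (B i) (mB i)).
move=> u0 mB.
pose u' i := if i == a then 0 else u i.
have u'0 i : i \notin s -> u' i = 0.
  by rewrite /u'; case: eqP => // /eqP ia si; apply: u0; rewrite inE negb_or ia.
pose D := \bigcap_(i in [set i | i != a]) (e i @^-1` B i).
have mD : measurable D.
  apply: fin_bigcap_measurable => [|i _]; first exact: finite_finset.
  by rewrite -[X in measurable X]setTI; exact: measurable_funP.
pose c := \prod_(i | i != a) fine (normal_prob (u i) sigma (B i)).
pose Y w := \1_D w * joint_lr u' w.
have c0 : 0 <= c.
  by apply: prodr_ge0 => i _; rewrite fine_ge0.
have -> : (\int[P]_(w in box B) (joint_lr u w)%:E =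
   \int[P]_w ((Y w)%:E * (\1_(B a) (e a w) * gauss_lr sigma (u a) (e a w))%:E))%E.
  rewrite integral_mkcond; apply: eq_integral => w _.
  rewrite patchE -EFinM.
  have -> : joint_lr u w = joint_lr u' w * gauss_lr sigma (u a) (e a w).
    rewrite /joint_lr (bigD1 a)//= [in RHS](bigD1 a)//=.
    rewrite {1}/u' eqxx gauss_lr0 mul1r mulrC; congr (_ * _).
    by apply: eq_bigr => i ia; rewrite /u' (negbTE ia).
  rewrite /Y !indicE.
  case: ifPn => [/set_mem/(boxE B a)[wD wB]|wN].
    by rewrite !mem_set// !mul1r.
  have [wB|] := boolP (e a w \in B a); last by rewrite mul0r mulr0.
  have [wD|] := boolP (w \in D); last by rewrite !mul0r.
  by case/negP: wN; apply/mem_set/(boxE B a); split; exact: set_mem.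
rewrite (@ge0_integral_transfer _ _ _ _ _ P lebesgue_measure (e a) Y
   (fun x => c * normal_pdf 0 sigma x) _ _ _ _ _ _
   (fun x => (\1_(B a) x * gauss_lr sigma (u a) x)%:E))//.
- rewrite (bigD1 a)//= EFinM fineN// muleC.
  transitivity (\int[lebesgue_measure]_(x in B a)
      (c%:E * (normal_pdf (u a) sigma x)%:E))%E.
    rewrite [in RHS]integral_mkcond; apply: eq_integral => x _.
    rewrite patchE -!EFinM -(gauss_lr_pdf (u a)) indicE.
    by case: ifP => _; rewrite ?mul1r ?mul0r ?mulr0// !mulrA.
  rewrite ge0_integralZl//.
  - exact: mB.
  - by apply/measurable_EFinP/measurable_funTS; exact: measurable_normal_pdf.
  - by move=> x _; rewrite lee_fin normal_pdf_ge0.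
- exact: (measurable_funP (e a)).
- by apply: measurable_funM => //; exact: measurable_indic.
- by apply: measurable_funM => //; exact: measurable_normal_pdf.
- by move=> w; rewrite mulr_ge0.
- by move=> x; rewrite mulr_ge0// normal_pdf_ge0.
- move=> A mA.
  (* Restricting the weight [Y] to [e a] in [A] gives again an integral over a box, now with side
     [A] at [a], and [u'] vanishes outside [s]. *)
  pose BA i := if i == a then A else B i.
  have mBA i : measurable (BA i).
    by rewrite /BA; case: ifP => _; [exact: mA|exact: mB].
  transitivity (\int[P]_(w in box BA) (joint_lr u' w)%:E)%E.
    rewrite integral_mkcond [in RHS]integral_mkcond; apply: eq_integral => w _.
    rewrite !patchE /Y indicE.
    have BAE : (w \in box BA) = (w \in e a @^-1` A) && (w \in D).
      apply/idP/andP => [/set_mem/(boxE BA a)[wD wA]|[/set_mem wA /set_mem wD]].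
        split; apply/mem_set; first by move: wA; rewrite /BA eqxx.
        by move=> i /= ia; have /= := wD i ia; rewrite /BA (negbTE ia).
      apply/mem_set/(boxE BA a); split; last by rewrite /BA eqxx.
      by move=> i /= ia; rewrite /BA (negbTE ia); exact: wD.
    by rewrite BAE; do 2 case: (_ \in _); rewrite ?mul1r ?mul0r.
  rewrite IH// (bigD1 a)//= {1}/u' {1}/BA eqxx.
  under eq_bigr => i ia do rewrite /u' /BA (negbTE ia).
  rewrite mulrC EFinM fineN// -ge0_integralZl//.
  - by apply/measurable_EFinP/measurable_funTS; exact: measurable_normal_pdf.
  - by move=> x _; rewrite lee_fin normal_pdf_ge0.
- apply/measurable_EFinP; apply: measurable_funM.
    by apply: measurable_indic; exact: mB.
  exact: measurable_gauss_lr.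
- by move=> x; rewrite lee_fin mulr_ge0// expR_ge0.
Qed.


(** Unlike cylinders over one coordinate, boxes are closed under intersection, as the Dynkin
    argument below requires. *)
Let boxes : set (set (I -> R)) := [set C | exists B : I -> set R,
  (forall i, measurable (B i)) /\ C = \bigcap_i ((fun f => f i) @^-1` B i)].

Let out_measurable_boxes S : out_measurable S -> <<s boxes >> S.
Proof.
apply: smallest_sub; first exact: smallest_sigma_algebra.
move=> _ [i [B [mB ->]]]; apply: sub_sigma_algebra.
exists (fun j => if j == i then B else setT); split.
  by move=> j; case: ifP.
apply/seteqP; split => f /=.
  by move=> Bf j _ /=; case: eqP => // ->.
by move=> /(_ i Logic.I) /=; rewrite eqxx.
Qed.

Let preimage_boxes_measurable (X : Omega -> I -> R) S :
  (forall i, measurable_fun setT (X^~ i)) -> <<s boxes >> S ->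
  measurable (X @^-1` S).
Proof.
move=> mX; apply: g_sigma_preimage_measurable => _ [B [mB ->]].
rewrite preimage_bigcap; apply: fin_bigcap_measurable => // i _.
by have := mX i measurableT _ (mB i); rewrite setTI.
Qed.

Let gaussian_shift_boxes (v : I -> R) S : boxes S ->
  (P ((fun w i => e i w + v i)%R @^-1` S) =
   \int[P]_(w in (fun w => e^~ w) @^-1` S) (joint_lr v w)%:E)%E.
Proof.
move=> [B [mB ->]].
have -> : (fun w => e^~ w) @^-1` (\bigcap_i ((fun f : I -> R => f i) @^-1` B i)) = box B.
  by rewrite preimage_bigcap.
rewrite (@integral_box (enum I))//; last first.
  by move=> i; rewrite mem_enum.
pose B' i := shift (v i) @^-1` B i.
have mB' i : measurable (B' i).
  rewrite /B' -[X in measurable X]setTI.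
  by have : measurable_fun setT (shift (v i)); [exact: measurable_funD|exact].
have /(_ [set: I]%SET B' mB') := iid.2.
rewrite (_ : \bigcap_(i in _) _ = (fun w i => e i w + v i)%R @^-1`
    (\bigcap_i ((fun f : I -> R => f i) @^-1` B i))); last first.
  rewrite preimage_bigcap; apply: eq_bigcapl; split=> i //= _; rewrite inE.
move=> ->; rewrite -prodEFin; apply: eq_big => [i|i _]; first by rewrite inE.
rewrite fineN// -normal_prob_shift//; exact: (iid.1 i (B' i) (mB' i)).
Qed.

(** The identity holds on boxes by independence, and the sets on which it holds form a
    lambda-system, so the pi-lambda theorem extends it. *)
Lemma gaussian_shift (v : I -> R) S : out_measurable S ->
  (P ((fun w i => e i w + v i)%R @^-1` S) =
   \int[P]_(w in (fun w => e^~ w) @^-1` S)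
      (\prod_i gauss_lr sigma (v i) (e i w))%:E)%E.
Proof.
move=> /out_measurable_boxes mS.
have mev i : measurable_fun setT (fun w => e i w + v i) by exact: measurable_funD.
have me i : measurable_fun setT (e i) by exact: measurable_funP.
have bT : boxes setT.
  by exists (fun=> setT); split => //; apply/seteqP; split.
pose Q S := (P ((fun w i => e i w + v i)%R @^-1` S) =
   \int[P]_(w in (fun w => e^~ w) @^-1` S) (joint_lr v w)%:E)%E.
have mlr A : measurable_fun A (EFin \o joint_lr v).
  by apply/measurable_EFinP; exact: measurable_funTS.
have [s0' sC sU] := smallest_sigma_algebra setT boxes.
(* Membership in the sigma-algebra is carried along with [Q], since additivity needs measurable
   preimages. *)
suff: <<s boxes >> `<=` [set A | <<s boxes >> A /\ Q A] by move=> /(_ S mS)[].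
apply: lambda_system_subset; [|apply/dynkin_lambda_system; split|..] => //.
- move=> _ _ [B [mB ->]] [C [mC ->]]; exists (fun i => B i `&` C i); split.
    by move=> i; exact: measurableI.
  by rewrite -bigcapI.
- by split; [exact: sub_sigma_algebra|exact: gaussian_shift_boxes].
- move=> A [mA PA]; split; first by rewrite -setTD; exact: sC.
  (* The whole space is a box; its identity is split along [A], and the finite term of [A] is
     subtracted. *)
  have : Q (A `|` ~` A) by rewrite setUv; exact: gaussian_shift_boxes.
  have mA1 := preimage_boxes_measurable mev mA.
  have mA2 := preimage_boxes_measurable me mA.
  pose X w i := e i w + v i; pose Y w : I -> R := e^~ w.
  change (P (X @^-1` A `|` ~` (X @^-1` A)) =
    \int[P]_(w in Y @^-1` A `|` ~` (Y @^-1` A)) (joint_lr v w)%:E ->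
    P (~` (X @^-1` A)) =
    \int[P]_(w in ~` (Y @^-1` A)) (joint_lr v w)%:E)%E.
  rewrite measureU ?setICr//; last exact: measurableC.
  rewrite ge0_integral_setU//; last 3 first.
  - exact: measurableC.
  - by move=> w _; rewrite lee_fin.
  - by apply/disj_setPS => x [].
  have {}PA : P (X @^-1` A) = (\int[P]_(w in Y @^-1` A) (joint_lr v w)%:E)%E := PA.
  rewrite -PA => /(congr1 (fun z => z - P (X @^-1` A))%E).
  by rewrite ![(P (X @^-1` A) + _)%E]addeC !addeK// fin_num_measure.
- move=> F tF mPF; have mF n := (mPF n).1; have PF n := (mPF n).2.
  split; first exact: sU.
  have tpre (Z : Omega -> I -> R) : trivIset setT (fun n => Z @^-1` F n).
    by move=> i j _ _ [w [Fi Fj]]; apply: tF => //; exists (Z w).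
  rewrite /Q !preimage_bigcup measure_bigcup; last 2 first.
  + by move=> n _; exact: preimage_boxes_measurable.
  + exact: tpre.
  rewrite ge0_integral_bigcup; last 4 first.
  + by move=> n; exact: preimage_boxes_measurable.
  + exact: mlr.
  + by move=> w _; rewrite lee_fin.
  + exact: tpre.
  rewrite (@eq_eseriesl R _ xpredT) => [|n]; last by rewrite in_setT.
  by apply: eq_eseriesr => n _; exact: PF.
- by move=> A bA; split; [exact: sub_sigma_algebra|exact: gaussian_shift_boxes].
Qed.

End gaussian_shift.

(** * The Gaussian mechanism *)

Section hockey_stick.
Context {R : realType}.
Implicit Types (u x q eps delta lam D : R).

(** For [u > 0] put [y = expR (u / 2)]: as [1 + lam >= 3/2], the last exponential is at least
    [y ^+ 3], and the cubic [y^3 - 2 y^2 + 2] is nonnegative for [y > 0]. *)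
Lemma expR_sub1_le u lam : 2^-1 <= lam ->
  expR u <= 1 + 2^-1 * expR ((1 + lam) * u).
Proof.
move=> hl; have [u0|u0] := leP u 0.
  apply: (@le_trans _ _ 1); first by rewrite expR_le1.
  by rewrite lerDl mulr_ge0// expR_ge0.
set y := expR (u / 2).
have y1 : 1 < y by rewrite /y expR_gt1; lra.
have -> : expR u = y ^+ 2 by rewrite -expRM_natl; congr expR; field.
have : y ^+ 3 <= expR ((1 + lam) * u).
  rewrite -expRM_natl ler_expR; nra.
have : 0 <= y ^+ 3 - 2 * y ^+ 2 + 2.
  (* The cubic is [y (y - 1)^2 + (2 - y)], which settles [y <= 2], and also [y^2 (y - 2) + 2], which
     settles [y > 2]. *)
  have := mulr_ge0 (ltW (lt_trans ltr01 y1)) (sqr_ge0 (y - 1)).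
  by have [y2|y2] := leP y 2; nra.
lra.
Qed.

(** From [1 - x / 2 <= expR (- (x / 2))] and [(20/13)^2 <= 5/2]. *)
Lemma expR_le_5half x : x <= 7 / 10 -> expR x <= 5 / 2.
Proof.
move=> hx; have h : 13 / 20 <= expR (- (x / 2)).
  by apply: le_trans (expR_ge1Dx _); lra.
have -> : expR x = (expR (- (x / 2)) ^+ 2)^-1.
  by rewrite -expRM_natl -expRN; congr expR; field.
by rewrite -[5/2]invrK lef_pV2 ?posrE ?exprn_gt0 ?expR_gt0//; nra.
Qed.

Lemma gaussian_delta_bound eps delta Delta D :
  0 < eps <= 1 -> 0 < delta <= 1 -> 0 < Delta -> 0 <= D <= Delta ^+ 2 ->
  exists2 lam, 2^-1 <= lam &
  2^-1 * expR (lam * (1 + lam) * D / (fpm_sigma eps delta Delta ^+ 2 *+ 2)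
               - lam * eps) <= delta.
Proof.
move=> /andP[e0 e1] /andP[d0 d1] Dt0 /andP[D0 D1].
pose q := 2 * ln (5 / 4 / delta).
have r0 : 0 < 5 / 4 / delta by rewrite divr_gt0.
(* [delta <= 1] keeps [q] away from 0; the case [q < eps] at the end relies on this bound. *)
have hq : 2 / 5 <= q.
  have : 1 + (- ln (5 / 4 / delta)) <= expR (- ln (5 / 4 / delta)).
    exact: expR_ge1Dx.
  rewrite expRN lnK ?posrE// invf_div /q; lra.
have q0 : 0 < q by lra.
have dE : delta = 5 / 4 * expR (- (q / 2)).
  rewrite (_ : q / 2 = ln (5 / 4 / delta)); last by rewrite /q; field.
  by rewrite expRN lnK ?posrE//; field; rewrite gt_eqF.
have s2 : fpm_sigma eps delta Delta ^+ 2 = q * Delta ^+ 2 / eps ^+ 2.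
  by rewrite /fpm_sigma -/q expr_div_n exprMn sqr_sqrtr// ltW.
(* The worst case is [D = Delta ^+ 2]. As [delta] is [5/4 * expR (- (q / 2))] and the bound carries
   a factor 1/2, the exponent plus [q / 2] may reach ln(5/2), which exceeds 7/10. *)
suff [lam l2 hlam] : exists2 lam, 2^-1 <= lam &
    lam * (1 + lam) * (eps ^+ 2 / (2 * q)) - lam * eps + q / 2 <= 7 / 10.
  exists lam => //.
  have : expR (lam * (1 + lam) * (eps ^+ 2 / (2 * q)) - lam * eps) <=
      5 / 2 * expR (- (q / 2)).
    rewrite expRN ler_pdivlMr ?expR_gt0// -expRD.
    exact: expR_le_5half.
  move=> hY; rewrite [leRHS]dE; suff :
      expR (lam * (1 + lam) * D / (fpm_sigma eps delta Delta ^+ 2 *+ 2)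
            - lam * eps) <=
      expR (lam * (1 + lam) * (eps ^+ 2 / (2 * q)) - lam * eps).
    by move: hY; lra.
  rewrite ler_expR lerD2r -mulrA ler_wpM2l//; first by nra.
  rewrite s2 ler_pdivrMr; last first.
    by rewrite pmulrn_lgt0// divr_gt0 ?exprn_gt0// mulr_gt0// exprn_gt0.
  rewrite (_ : _ / _ * _ = Delta ^+ 2)//.
  by field; rewrite !gt_eqF.
(* [q / eps - 1/2] minimises the exponent; it is below 1/2 only if [q < eps],
   and then [delta] is so close to 1 that [lam = 1/2] suffices. *)
have [qe|qe] := leP eps q.
  exists (q / eps - 2^-1).
    have : 1 <= q / eps by rewrite ler_pdivlMr// mul1r.
    lra.
  rewrite [leLHS](_ : _ = eps / 2 - eps ^+ 2 / (8 * q)); last first.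
    by field; rewrite !gt_eqF.
  have : 0 <= eps ^+ 2 / (8 * q) by rewrite divr_ge0// ?sqr_ge0; lra.
  lra.
exists 2^-1 => //.
rewrite [leLHS](_ : _ = (3 / 8 * eps ^+ 2 - eps / 2 * q + q ^+ 2 / 2) / q); last first.
  by field; rewrite !gt_eqF.
by rewrite ler_pdivrMr//; nra.
Qed.

End hockey_stick.

Lemma out_measurable_preimage d (Omega : measurableType d) (R : realType)
    (I : Type) (X : Omega -> I -> R) (S : set (I -> R)) :
  (forall i, measurable_fun setT (X^~ i)) -> out_measurable S ->
  measurable (X @^-1` S).
Proof.
move=> mX; apply: g_sigma_preimage_measurable => _ [i [B [mB ->]]].
by have := mX i measurableT _ mB; rewrite setTI.
Qed.

Lemma prod_gauss_lr (R : realType) (I : finType) (s : R) (v x : I -> R) :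
  \prod_i gauss_lr s (v i) (x i) =
  expR (\sum_i (v i * x i / s ^+ 2 - v i ^+ 2 / (s ^+ 2 *+ 2))).
Proof. by rewrite expR_sum. Qed.

Section gaussian_mechanism.
Context d (Omega : measurableType d) (R : realType) (P : probability Omega R).
Variables (I : finType) (e : I -> {RV P >-> R}) (eps delta Delta : R).
Hypotheses (eps01 : 0 < eps <= 1) (delta01 : 0 < delta <= 1) (Delta0 : 0 < Delta).
Hypothesis iid : iid_normal e (fpm_sigma eps delta Delta).

Let sigma := fpm_sigma eps delta Delta.

Let sigma0 : sigma != 0.
Proof.
case/andP: eps01 => e0 _; case/andP: delta01 => d0 d1.
rewrite /sigma /fpm_sigma !mulf_neq0 ?invr_eq0 ?gt_eqF//.
rewrite sqrtr_gt0 mulr_gt0// ln_gt0// ltr_pdivlMr// mul1r; lra.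
Qed.

Lemma gaussian_mechanism (a b : I -> R) S :
  \sum_i (a i - b i) ^+ 2 <= Delta ^+ 2 -> out_measurable S ->
  (P ((fun w i => a i + e i w)%R @^-1` S) <=
   (expR eps)%:E * P ((fun w i => b i + e i w)%R @^-1` S) + delta%:E)%E.
Proof.
move=> abD mS; set D := \sum_i _ in abD.
have D0 : 0 <= D <= Delta ^+ 2.
  by rewrite abD sumr_ge0// => i _; exact: sqr_ge0.
have [lam hlam hdelta] := gaussian_delta_bound eps01 delta01 Delta0 D0.
(* Up to a constant factor, the likelihood ratio of [c] is
   [lr a ^ (1 + lam) / lr b ^ lam]. *)
pose c i := (1 + lam) * a i - lam * b i.
pose lr (v : I -> R) w := \prod_i gauss_lr sigma (v i) (e i w).
pose C := 2^-1 * expR (lam * (1 + lam) * D / (sigma ^+ 2 *+ 2) - lam * eps).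
have C0 : 0 <= C by rewrite mulr_ge0// expR_ge0.
have lr_ge0 v w : 0 <= lr v w by apply: prodr_ge0 => i _; exact: expR_ge0.
have mlr A v : measurable_fun A (EFin \o lr v).
  apply/measurable_EFinP/measurable_funTS/measurable_prod => i _.
  by apply: measurableT_comp => //; exact: measurable_gauss_lr.
have lr_le w : lr a w <= expR eps * lr b w + C * lr c w.
  rewrite /lr !prod_gauss_lr.
  set A := \sum_i _; set A' := \sum_i _; set A'' := \sum_i _.
  (* [A], [A'], [A''] are the logarithms of the likelihood ratios of [a], [b], [c]. The identity
     comes from |c|^2 = (1 + lam)|a|^2 - lam |b|^2 + lam (1 + lam)|a - b|^2. *)
  have cE : A'' + lam * (1 + lam) * D / (sigma ^+ 2 *+ 2) =
      (1 + lam) * A - lam * A'.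
    rewrite /A'' /A /A' /D !mulr_sumr mulr_suml -sumrB -big_split/=.
    by apply: eq_bigr => i _; rewrite /c; field.
  have := expR_sub1_le (A - A' - eps) hlam.
  rewrite -(ler_pM2l (expR_gt0 (A' + eps))).
  have -> : expR (A' + eps) * expR (A - A' - eps) = expR A.
    by rewrite -expRD; congr expR; ring.
  move/le_trans; apply.
  rewrite mulrDr mulr1 [in leLHS]expRD [expR A' * _]mulrC lerD2l mulrCA /C -mulrA.
  rewrite ler_wpM2l// -!expRD ler_expR le_eqVlt; apply/orP; left.
  apply/eqP; move: cE; set z := _ / _; move=> cE.
  by have -> : A'' = (1 + lam) * A - lam * A' - z; [rewrite -cE addrK|ring].
have shiftE v : P ((fun w i => v i + e i w)%R @^-1` S) =
    (\int[P]_(w in (fun w => e^~ w) @^-1` S) (lr v w)%:E)%E.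
  rewrite -(gaussian_shift sigma0 iid)//; congr (P (_ @^-1` S)).
  by apply/funext => w; apply/funext => i; rewrite addrC.
have mS' : measurable ((fun w => e^~ w) @^-1` S).
  by apply: out_measurable_preimage => // i; exact: measurable_funP.
(* By [shiftE] this integral is the probability of an event. *)
have intc : (\int[P]_(w in (fun w => e^~ w) @^-1` S) (lr c w)%:E <= 1)%E.
  by rewrite -shiftE; apply/probability_le1/out_measurable_preimage => // i;
    exact: measurable_funD.
rewrite !shiftE.
apply: (@le_trans _ _ (\int[P]_(w in (fun w => e^~ w) @^-1` S)
   ((expR eps)%:E * (lr b w)%:E + C%:E * (lr c w)%:E))%E).
  apply: ge0_le_integral => //.
  - by move=> w _; rewrite lee_fin.
  - exact: mlr.
  - by apply: emeasurable_funD; apply: measurable_funeM; exact: mlr.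
  - by move=> w _; rewrite -!EFinM -EFinD lee_fin.
rewrite ge0_integralD//; last 4 first.
- by move=> w _; rewrite -EFinM lee_fin mulr_ge0// expR_ge0.
- by apply: measurable_funeM; exact: mlr.
- by move=> w _; rewrite -EFinM lee_fin mulr_ge0.
- by apply: measurable_funeM; exact: mlr.
rewrite !ge0_integralZl//; try exact: mlr; try by move=> w _; rewrite lee_fin.
- apply: leeD2l; apply: (@le_trans _ _ (C%:E * 1)%E).
    by apply: lee_wpmul2l => //; rewrite lee_fin.
  by rewrite mule1 lee_fin.
Qed.

End gaussian_mechanism.

(** * Monomials and sensitivity *)

Section monomials.
Variables (R : realType) (m k : nat).
Implicit Types (p : {ffun 'I_m -> 'I_k.+1}) (x y : 'I_m -> R).

(** The exponent vector of the monomial spelled by the word [f]. For [i <= k] every count fits, so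
    [inord] never falls back to its default 0. *)
Definition content i (f : {ffun 'I_i -> 'I_m}) : {ffun 'I_m -> 'I_k.+1} :=
  [ffun j => inord #|[pred t | f t == j]|].

(** For [i <= k] and [p] of order [i], the multinomial coefficient. *)
Definition arrangements i p := #|[pred f : {ffun 'I_i -> 'I_m} | content f == p]|.

Lemma contentE i (f : {ffun 'I_i -> 'I_m}) j : (i <= k)%N ->
  content f j = #|[pred t | f t == j]| :> nat.
Proof.
move=> ik; rewrite ffunE inordK// ltnS (leq_trans _ ik)//.
by rewrite (leq_trans (max_card _))// card_ord.
Qed.

Lemma mono_order_content i (f : {ffun 'I_i -> 'I_m}) : (i <= k)%N ->
  mono_order (content f) = i.
Proof.
move=> ik; rewrite /mono_order; under eq_bigr do rewrite contentE// -sum1_card.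
rewrite -[RHS]card_ord -[in RHS]sum1_card (partition_big f xpredT)//=.
Qed.

Lemma eval_mono_content i (f : {ffun 'I_i -> 'I_m}) x : (i <= k)%N ->
  eval_mono x (content f) = \prod_t x (f t).
Proof.
move=> ik; rewrite (partition_big f xpredT)//=; apply: eq_bigr => j _.
rewrite contentE// -prodr_const; apply: eq_big => // t /eqP ->//.
Qed.

(** Distributing the product gives a sum over all words of length [i], which are then grouped by
    content. *)
Lemma multinomial_expansion i x : (i <= k)%N ->
  (\sum_j x j) ^+ i =
  \sum_(p | mono_order p == i) (arrangements i p)%:R * eval_mono x p.
Proof.
move=> ik; rewrite -[in LHS](card_ord i) -prodr_const bigA_distr_bigA/=.
rewrite (partition_big (@content i) (fun p => mono_order p == i))/=; last first.
  by move=> f _; rewrite mono_order_content.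
apply: eq_bigr => p _; rewrite mulr_natl -sumr_const.
apply: eq_bigr => f /eqP <-; exact/esym/eval_mono_content.
Qed.

(** The word that repeats each variable [j] exactly [p j] times. *)
Lemma exists_content i p : (i <= k)%N -> mono_order p = i ->
  exists f : {ffun 'I_i -> 'I_m}, content f = p.
Proof.
move=> ik pi; pose s := flatten [seq nseq (p j) j | j <- index_enum 'I_m].
have cs j : count_mem j s = p j.
  rewrite count_flatten sumnE !big_map/= (bigD1 j)//=.
  rewrite count_nseq /= eqxx mul1n big1 ?addn0// => j' jj'.
  by rewrite count_nseq /= (negbTE jj').
have ss : size s = i.
  rewrite size_flatten sumnE !big_map/= -pi.
  by apply: eq_bigr => j _; rewrite size_nseq.
rewrite -{}ss in ik *; exists [ffun t => tnth (in_tuple s) t].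
apply/ffunP => j; apply/val_inj => /=; rewrite contentE// -cs -sum1_count.
rewrite big_tnth -sum1_card; apply: eq_bigl => t.
by rewrite inE ffunE.
Qed.

Lemma arrangements_gt0 i p : (i <= k)%N -> mono_order p = i ->
  (0 < arrangements i p)%N.
Proof.
move=> ik /(exists_content ik)[f fp]; apply/card_gt0P.
by exists f; rewrite inE fp.
Qed.

(** Swapping a position that holds [j1] with one that holds [j2] changes the word but not its
    content. *)
Lemma arrangements_gt1 i p j1 j2 : (i <= k)%N -> mono_order p = i ->
  j1 != j2 -> (0 < p j1)%N -> (0 < p j2)%N -> (1 < arrangements i p)%N.
Proof.
move=> ik /(exists_content ik)[f fp] j12; rewrite -fp !contentE//.
move=> /card_gt0P[t1 /eqP ft1] /card_gt0P[t2 /eqP ft2].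
apply/card_gt1P; exists f, [ffun t => f (tperm t1 t2 t)].
rewrite !inE eqxx; split => //.
  apply/eqP/ffunP => j; apply/val_inj => /=; rewrite !contentE// -!sum1_card.
  rewrite [RHS](reindex_inj (@perm_inj _ (tperm t1 t2)))/=.
  by apply: eq_bigl => t; rewrite !inE ffunE.
apply: contra j12 => /eqP/ffunP/(_ t1); rewrite ffunE tpermL => E.
by rewrite -ft1 -ft2 E.
Qed.

Lemma eval_mono_sqr x p : eval_mono x p ^+ 2 = eval_mono (fun j => x j ^+ 2) p.
Proof. by rewrite -prodrXl; apply: eq_bigr => j _; rewrite exprAC. Qed.

(** The multinomial weights are kept because the even case of the sensitivity bound needs this
    stronger form. *)
Lemma sum_arrangements_sqr_le i x (B : R) : (i <= k)%N -> 0 <= B -> l2norm x <= B ->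
  \sum_(p | mono_order p == i) (arrangements i p)%:R * eval_mono x p ^+ 2
  <= B ^+ (2 * i).
Proof.
move=> ik B0 xB; under eq_bigr do rewrite eval_mono_sqr.
have s0 : 0 <= \sum_j x j ^+ 2 by apply: sumr_ge0 => j _; exact: sqr_ge0.
rewrite -multinomial_expansion// exprM lerXn2r ?nnegrE ?exprn_ge0//.
rewrite -(sqr_sqrtr s0) lerXn2r ?nnegrE//; exact: sqrtr_ge0.
Qed.

Lemma sum_sqr_le i x (B : R) : (i <= k)%N -> 0 <= B -> l2norm x <= B ->
  \sum_(p : {ffun 'I_m -> 'I_k.+1} | mono_order p == i) eval_mono x p ^+ 2
  <= B ^+ (2 * i).
Proof.
move=> ik B0 xB; apply: le_trans (sum_arrangements_sqr_le ik B0 xB).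
apply: ler_sum => p /eqP pi; rewrite ler_peMl ?sqr_ge0//.
by rewrite ler1n arrangements_gt0.
Qed.

Lemma eval_mono_even_ge0 x p : (forall j, ~~ odd (p j)) -> 0 <= eval_mono x p.
Proof. by move=> ep; apply: prodr_ge0 => j _; exact: exprn_even_ge0. Qed.

(* A monomial of even order that can be negative contains two variables with
   odd exponents, hence has at least two arrangements. *)
Lemma even_order_sqrB_le i x y p : (i <= k)%N -> ~~ odd i -> mono_order p = i ->
  (eval_mono x p - eval_mono y p) ^+ 2 <=
  (arrangements i p)%:R * (eval_mono x p ^+ 2 + eval_mono y p ^+ 2).
Proof.
move=> ik ei pi; set a := eval_mono x p; set b := eval_mono y p.
have ab0 : 0 <= a ^+ 2 + b ^+ 2 by rewrite addr_ge0// sqr_ge0.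
have [ep|] := boolP [forall j, ~~ odd (p j)].
  have a0 : 0 <= a by apply: eval_mono_even_ge0; exact/forallP.
  have b0 : 0 <= b by apply: eval_mono_even_ge0; exact/forallP.
  have : 1 <= (arrangements i p)%:R :> R by rewrite ler1n arrangements_gt0.
  by have := mulr_ge0 a0 b0; nra.
rewrite negb_forall => /existsP[j1]; rewrite negbK => oj1.
have [j2 j12 pj2] : exists2 j2, j1 != j2 & (0 < p j2)%N.
  case: (pickP (fun j2 => (j1 != j2) && (0 < p j2)%N)) => [j2 /andP[? ?]|none].
    by exists j2.
  (* If [j1] were the only variable of [p], the order [i] would be the odd number [p j1]. *)
  exfalso; move: ei; rewrite -pi /mono_order (bigD1 j1)//= big1 ?addn0 ?oj1//.
  move=> j jj1; have := none j; rewrite eq_sym jj1/=.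
  by case: (nat_of_ord (p j)).
have : 2 <= (arrangements i p)%:R :> R.
  rewrite (ler_nat _ 2); apply: (@arrangements_gt1 _ _ j1 j2) => //.
  by rewrite odd_gt0.
have := sqr_ge0 (a + b); nra.
Qed.

End monomials.

Lemma sqrB_le (R : realFieldType) (a b : R) :
  (a - b) ^+ 2 <= 2 * a ^+ 2 + 2 * b ^+ 2.
Proof. have := sqr_ge0 (a + b); nra. Qed.

(** Odd order: the bound [2 a^2 + 2 b^2] on each term sums to the factor 4. Even order: the weighted
    bound gives one [B ^+ (2 * i)] for each of [x] and [y]. *)
Lemma sum_sqrB_le (R : realType) (m k i : nat) (x y : 'I_m -> R) (B : R) :
  (i <= k)%N -> (0 < m)%N -> 0 <= B -> l2norm x <= B -> l2norm y <= B ->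
  \sum_(p : {ffun 'I_m -> 'I_k.+1} | mono_order p == i)
    (eval_mono x p - eval_mono y p) ^+ 2 <= c_coef m i * B ^+ (2 * i).
Proof.
move=> ik m0 B0 xB yB; rewrite /c_coef; case: ifPn => [oi|ei].
  have hx := sum_sqr_le ik B0 xB; have hy := sum_sqr_le ik B0 yB.
  apply: (@le_trans _ _ (\sum_(p : {ffun 'I_m -> 'I_k.+1} | mono_order p == i)
      (2 * eval_mono x p ^+ 2 + 2 * eval_mono y p ^+ 2))).
    by apply: ler_sum => p _; exact: sqrB_le.
  rewrite big_split/= -!mulr_sumr; lra.
case: eqVneq => [m1|_].
  (* With one feature the only monomial is an even power; both values are nonnegative, so the
     squared difference is at most the larger square. *)
  subst m; pose p0 : {ffun 'I_1 -> 'I_k.+1} := [ffun=> inord i].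
  have pE (p : {ffun 'I_1 -> 'I_k.+1}) : (mono_order p == i) = (p == p0).
    rewrite /mono_order big_ord_recl big_ord0 addn0; apply/eqP/eqP => [pi|->].
      by apply/ffunP => j; rewrite ffunE -pi ord1; apply/val_inj; rewrite /= inordK.
    by rewrite ffunE inordK.
  have := sum_sqr_le ik B0 xB; have := sum_sqr_le ik B0 yB.
  rewrite !(big_pred1 p0 pE)/= mul1r => hy hx.
  have ep0 j : ~~ odd (p0 j) by rewrite ffunE inordK.
  have := eval_mono_even_ge0 x ep0; have := eval_mono_even_ge0 y ep0.
  set a := eval_mono x p0 in hx *; set b := eval_mono y p0 in hy *; move=> b0 a0.
  by have [ab|/ltW ab] := leP a b; nra.
have hx := sum_arrangements_sqr_le ik B0 xB.
have hy := sum_arrangements_sqr_le ik B0 yB.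
apply: (@le_trans _ _ (\sum_(p : {ffun 'I_m -> 'I_k.+1} | mono_order p == i)
   ((arrangements i p)%:R * eval_mono x p ^+ 2 +
    (arrangements i p)%:R * eval_mono y p ^+ 2))).
  apply: ler_sum => p /eqP pi; rewrite -mulrDr.
  exact: even_order_sqrB_le.
rewrite big_split/=; lra.
Qed.

Lemma sum_by_order (R : realType) (m k a : nat) (F : {ffun 'I_m -> 'I_k.+1} -> R) :
  \sum_(p | (a <= mono_order p <= k)%N) F p =
  \sum_(a <= i < k.+1) \sum_(p | mono_order p == i) F p.
Proof.
rewrite big_mkcond/= (eq_bigr (fun p =>
  \sum_(a <= i < k.+1) if mono_order p == i then F p else 0)).
  by rewrite exchange_big/=; apply: eq_bigr => i _; rewrite -big_mkcond.
move=> p _; case: ifPn => [pk|pk].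
  rewrite (bigD1_seq (mono_order p)) ?iota_uniq ?mem_index_iota//= eqxx.
  by rewrite big1 ?addr0// => i; rewrite eq_sym => /negbTE ->.
rewrite big_nat big1// => i; case: eqP => // <-.
by rewrite ltnS (negbTE pk).
Qed.

Lemma sum_order_sqrB_le (R : realType) (m k : nat) (x y : 'I_m -> R) (B : R) :
  (0 < m)%N -> 0 <= B -> l2norm x <= B -> l2norm y <= B ->
  \sum_(p : {ffun 'I_m -> 'I_k.+1} | (0 < mono_order p <= k)%N)
    (eval_mono x p - eval_mono y p) ^+ 2 <= Delta_u m k B ^+ 2.
Proof.
move=> m0 B0 xB yB; rewrite sum_by_order sqr_sqrtr.
  rewrite big_nat [leRHS]big_nat; apply: ler_sum => i /andP[_ ik].
  exact: sum_sqrB_le.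
apply: sumr_ge0 => i _; rewrite mulr_ge0 ?exprn_ge0// /c_coef.
by case: ifP => // _; case: ifP.
Qed.

Lemma sum_le_order_sqr_le (R : realType) (m k : nat) (x : 'I_m -> R) (B : R) :
  0 <= B -> l2norm x <= B ->
  \sum_(p : {ffun 'I_m -> 'I_k.+1} | (mono_order p <= k)%N) eval_mono x p ^+ 2
  <= \sum_(0 <= i < k.+1) B ^+ (2 * i).
Proof.
move=> B0 xB; rewrite (sum_by_order 0) big_nat [leRHS]big_nat.
by apply: ler_sum => i /andP[_ ik]; exact: sum_sqr_le.
Qed.

Lemma big_sig (R : nmodType) (I : finType) (Q : pred I) (F : I -> R) :
  \sum_(i : {i | Q i}) F (val i) = \sum_(i | Q i) F i.
Proof. by rewrite -(big_sub Q F). Qed.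

(** * Sensitivity of the exact answers *)

Section sensitivity.
Variables (R : realType) (m k : nat) (B : R).
Hypotheses (m0 : (0 < m)%N) (k0 : (0 < k)%N) (B0 : 0 < B).

Lemma Delta_u_gt0 : 0 < Delta_u m k B.
Proof.
rewrite sqrtr_gt0 big_nat_recl// ltr_pwDl//.
  by rewrite /c_coef /= mulr_gt0// exprn_gt0.
apply: sumr_ge0 => i _; rewrite mulr_ge0 ?exprn_ge0 ?(ltW B0)// /c_coef.
by case: ifP => // _; case: ifP.
Qed.

Lemma Delta_u_le_join : Delta_u m k B <= Delta_join m k B.
Proof. by rewrite /Delta_join le_max lexx. Qed.

Lemma Delta_join_ge_sqr :
  2 * \sum_(0 <= i < k.+1) B ^+ (2 * i) <= Delta_join m k B ^+ 2.
Proof.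
set s := _ * _; have s0 : 0 <= s.
  by rewrite mulr_ge0// sumr_ge0// => i _; rewrite exprn_ge0// ltW.
rewrite -[leLHS](sqr_sqrtr s0) lerXn2r ?nnegrE ?sqrtr_ge0//.
  exact: le_trans (sqrtr_ge0 _) Delta_u_le_join.
by rewrite /Delta_join le_max lexx orbT.
Qed.

Lemma union_sensitivity n (r1 r2 : 'I_n -> 'I_m -> R) :
  neighbours (fun x => l2norm x <= B) r1 r2 ->
  \sum_(p : UMono m k) (\sum_(t < n) eval_mono (r1 t) (val p) -
                        \sum_(t < n) eval_mono (r2 t) (val p)) ^+ 2
  <= Delta_u m k B ^+ 2.
Proof.
move=> [ok1 [ok2 [i0 [_ r12]]]].
apply: le_trans (sum_order_sqrB_le k m0 (ltW B0) (ok1 i0) (ok2 i0)).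
rewrite -(big_sig (fun p => (0 < mono_order p <= k)%N)).
apply: ler_sum => p _; rewrite (bigD1 i0)//= [X in _ - X](bigD1 i0)//=.
rewrite [X in _ + X - _](eq_bigr (fun t => eval_mono (r2 t) (val p))).
  by rewrite opprD addrACA subrr addr0.
by move=> t ti; rewrite r12.
Qed.

Lemma join_diff n (K : finType) (r1 r2 : 'I_n -> ('I_m -> R) * K) i0 a
    (p : {ffun 'I_m -> 'I_k.+1}) :
  (forall j, j != i0 -> r1 j = r2 j) ->
  \sum_(t < n | (r1 t).2 == a) eval_mono (r1 t).1 p -
  \sum_(t < n | (r2 t).2 == a) eval_mono (r2 t).1 p =
  (if (r1 i0).2 == a then eval_mono (r1 i0).1 p else 0) -
  (if (r2 i0).2 == a then eval_mono (r2 i0).1 p else 0).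
Proof.
move=> r12; rewrite big_mkcond (bigD1 i0)//= [X in _ - X]big_mkcond.
rewrite [X in _ - X](bigD1 i0)//=.
rewrite [X in _ + X - _](eq_bigr (fun t =>
  if (r2 t).2 == a then eval_mono (r2 t).1 p else 0)).
  by ring.
by move=> t ti; rewrite r12.
Qed.

(** If the changed row keeps its key, one group changes as in the union case. Otherwise the
    monomials of [x] and [y] fall in different groups, so their squares add without cross terms. *)
Lemma join_sensitivity n (K : finType) (r1 r2 : 'I_n -> ('I_m -> R) * K) :
  neighbours (fun x => l2norm x.1 <= B) r1 r2 ->
  \sum_(ap : K * JMono m k)
    (\sum_(t < n | (r1 t).2 == ap.1) eval_mono (r1 t).1 (val ap.2) -
     \sum_(t < n | (r2 t).2 == ap.1) eval_mono (r2 t).1 (val ap.2)) ^+ 2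
  <= Delta_join m k B ^+ 2.
Proof.
move=> [ok1 [ok2 [i0 [_ r12]]]].
under eq_bigr do rewrite (join_diff _ _ r12).
have := ok1 i0; have := ok2 i0; move: (r1 i0) (r2 i0) => [x a1] [y a2] /= yB xB.
rewrite -(pair_bigA _ (fun a p => ((if a1 == a then eval_mono x (val p) else 0) -
    (if a2 == a then eval_mono y (val p) else 0)) ^+ 2))/=.
rewrite exchange_big/=.
rewrite (big_sig (fun p => (mono_order p <= k)%N) (fun p => \sum_a
  ((if a1 == a then eval_mono x p else 0) -
   (if a2 == a then eval_mono y p else 0)) ^+ 2)).
have [a12|a12] := eqVneq a1 a2.
  subst a2.
  have Delta_le : Delta_u m k B ^+ 2 <= Delta_join m k B ^+ 2.
    have D0 := Delta_u_gt0; have DD := Delta_u_le_join.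
    by rewrite lerXn2r ?nnegrE// ?(le_trans _ DD)// ltW.
  apply: le_trans Delta_le.
  apply: le_trans (sum_order_sqrB_le k m0 (ltW B0) xB yB).
  rewrite (eq_bigr (fun p => (eval_mono x p - eval_mono y p) ^+ 2)); last first.
    move=> p _; rewrite (bigD1 a1)//= !eqxx big1 ?addr0// => a.
    by rewrite eq_sym => /negbTE ->; rewrite subrr expr0n.
  (* The extra order-0 term vanishes: the constant monomial is 1 at both points. *)
  rewrite big_mkcond [leRHS]big_mkcond; apply: ler_sum => p _.
  case: (posnP (mono_order p)) => [p0|p0]; last by [].
  rewrite p0/= (_ : eval_mono x p = eval_mono y p) ?subrr ?expr0n//.
  apply: eq_bigr => j _; suff -> : nat_of_ord (p j) = 0%N by rewrite !expr0.
  by apply/eqP; move/eqP: p0; rewrite sum_nat_eq0 => /forallP/(_ j).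
apply: le_trans Delta_join_ge_sqr.
have hx := sum_le_order_sqr_le k (ltW B0) xB.
have hy := sum_le_order_sqr_le k (ltW B0) yB.
rewrite (eq_bigr (fun p => eval_mono x p ^+ 2 + eval_mono y p ^+ 2)); last first.
  move=> p _; rewrite (bigD1 a1)//= (bigD1 a2)/=; last by rewrite eq_sym.
  rewrite !eqxx [a2 == a1]eq_sym (negbTE a12) subr0 sub0r sqrrN big1 ?addr0// => a.
  move=> /andP[aa1 aa2]; rewrite eq_sym (negbTE aa1) eq_sym (negbTE aa2).
  by rewrite subrr expr0n.
rewrite big_split/=; lra.
Qed.

End sensitivity.

Unset Implicit Arguments.

Theorem theorem5 (R : realType) (eps delta B : R) (m k : nat)
  (K : finType) (d : measure_display) (Omega : measurableType d)
  (P : probability Omega R) :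
  0 < eps <= 1 -> 0 < delta <= 1 -> 0 < B -> (1 <= k)%N -> (1 <= m)%N ->
  (* union case, A = null *)
  (forall (n : nat) (e : UMono m k -> {RV P >-> R}),
     iid_normal e (fpm_sigma eps delta (Delta_u m k B)) ->
     DP P (@neighbours n ('I_m -> R) (fun x => l2norm x <= B))
        (@out_measurable R (UMono m k))
        (fun r => FPM_union r (fun p w => e p w)) eps delta) /\
  (* join case, join key A with public domain K *)
  (forall (n : nat) (e : (K * JMono m k)%type -> {RV P >-> R}),
     iid_normal e (fpm_sigma eps delta (Delta_join m k B)) ->
     DP P (@neighbours n (('I_m -> R) * K)%type (fun x => l2norm x.1 <= B))
        (@out_measurable R (K * JMono m k)%type)
        (fun r => FPM_join r (fun p w => e p w)) eps delta).
Proof.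
move=> eps01 delta01 B0 k0 m0; split=> n e iid r1 r2 r12 S mS.
- apply: (gaussian_mechanism eps01 delta01 _ iid) => //.
    exact: Delta_u_gt0.
  exact: union_sensitivity.
- apply: (gaussian_mechanism eps01 delta01 _ iid) => //.
    exact: lt_le_trans (Delta_u_gt0 m k0 B0) (Delta_u_le_join _ _ _).
  exact: join_sensitivity.
Qed.
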